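(* Let $K$ be a field and let $n,t\geq 1$ be integers. Let $p_1,\ldots,p_t\in\mathbb{A}^n(K)=K^n$ be points with $p_i\neq p_j$ whenever $i\neq j$. For each $i=1,\ldots,t$ let $s(i)\geq 1$, let $U_{i,1},\ldots,U_{i,s(i)}\in K^n$ be linearly independent unitary vectors, and let $H_i\subseteq\mathbb{N}^{s(i)}$ be a finite set such that whenever $h\in H_i$, $e\in\mathbb{N}^{s(i)}$ and $h-e\in\mathbb{N}^{s(i)}$, then $h-e\in H_i$. Let $v_{i,h}\in K$ be arbitrary for $i=1,\ldots,t$ and $h\in H_i$. Let $$I=\{F\in K[X_1,\ldots,X_n]\mid D^{(h)}F(p_i)=0\ \text{for every } i=1,\ldots,t \text{ and every } h\in H_i\},$$ which is an ideal of $K[X_1,\ldots,X_n]$. Then there exists a polynomial $F\in K[X_1,\ldots,X_n]$ such that $$D^{(h)}F(p_i)=v_{i,h}\quad\text{for every } i=1,\ldots,t \text{ and every } h\in H_i,$$ and $F$ is unique modulo the ideal $I$; that is, if $F_1,F_2\in K[X_1,\ldots,X_n]$ both satisfy these conditions, then $F_1-F_2\in I$.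
   Context: $\mathbb{N}=\{0,1,2,\ldots\}$. A vector $U=(u_1,\ldots,u_n)\in K^n$ is unitary if it has unit length, i.e. $u_1^2+\cdots+u_n^2=1$. For $U\in K^n$ and $h\in\mathbb{N}$, $D_U^{(h)}$ denotes the order-$h$ derivative in the direction $U$ on $K[X_1,\ldots,X_n]$, normalized so that the Leibniz rule reads $D_U^{(h)}(FG)=\sum_{k=0}^h D_U^{(h-k)}F\cdot D_U^{(k)}G$. Explicitly, $D_U^{(h)}F$ is the coefficient of $s^h$ in $F(X+sU)\in K[X_1,\ldots,X_n][s]$, where $X=(X_1,\ldots,X_n)$ and $s$ is an auxiliary variable; thus $D_U^{(0)}F=F$ and $D_U^{(1)}F$ is the usual directional derivative. For an index $i$ and $h=(h_1,\ldots,h_{s(i)})\in\mathbb{N}^{s(i)}$, when the derivative is evaluated at $p_i$, one sets $$D^{(h)}F=D^{(h_1)}_{U_{i,1}}\cdots D^{(h_{s(i)})}_{U_{i,s(i)}}F,$$ using the vectors attached to the index $i$. *)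

(* Defs.v *)
From mathcomp Require Import all_boot all_order all_algebra.
From mathcomp Require Export finmap.
From mathcomp Require Export mpoly.

Set Implicit Arguments.
Unset Strict Implicit.
Unset Printing Implicit Defensive.

Import GRing.Theory.
Local Open Scope ring_scope.

Definition unitary (K : fieldType) (n : nat) (U : 'rV[K]_n) : Prop :=
  \sum_(k < n) U 0 k ^+ 2 = 1.

(* F(X + sU), where s is the variable 'X of {poly {mpoly K[n]}}. *)
Definition shift_along (K : fieldType) (n : nat) (U : 'rV[K]_n)
    (F : {mpoly K[n]}) : {poly {mpoly K[n]}} :=
  mmap (fun c : K => c%:MP%:P)
       (fun k : 'I_n => ('X_k : {mpoly K[n]})%:P + (U 0 k)%:MP *: 'X) F.

(* The coefficient of s^h in F(X + sU), not the h-fold iterate of the directional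
   derivative, which is h`! times it (so 0 when the characteristic divides h`!). *)
Definition dderiv (K : fieldType) (n : nat) (U : 'rV[K]_n) (h : nat)
    (F : {mpoly K[n]}) : {mpoly K[n]} :=
  (shift_along U F)`_h.

(* D_{U_0}^(h_0) (D_{U_1}^(h_1) (... (D_{U_(s-1)}^(h_(s-1)) F))) *)
Definition mdderiv (K : fieldType) (n s : nat) (U : 'I_s -> 'rV[K]_n)
    (h : 'X_{1..s}) (F : {mpoly K[n]}) : {mpoly K[n]} :=
  foldr (fun (j : 'I_s) G => dderiv (U j) (h j) G) F (enum 'I_s).

Definition closed_under_sub (s : nat) (H : {fset 'X_{1..s}}) : Prop :=
  forall h e : 'X_{1..s}, h \in H -> (e <= h)%MM -> (h - e)%MM \in H.

Definition interpolates (K : fieldType) (n t : nat) (p : 'I_t -> 'rV[K]_n)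
    (s : 'I_t -> nat) (U : forall i : 'I_t, 'I_(s i) -> 'rV[K]_n)
    (H : forall i : 'I_t, {fset 'X_{1..s i}})
    (v : forall i : 'I_t, 'X_{1..s i} -> K) (F : {mpoly K[n]}) : Prop :=
  forall (i : 'I_t) (h : 'X_{1..s i}),
    h \in H i -> (mdderiv (U i) h F).@[p i 0] = v i h.

Definition vanishing (K : fieldType) (n t : nat) (p : 'I_t -> 'rV[K]_n)
    (s : 'I_t -> nat) (U : forall i : 'I_t, 'I_(s i) -> 'rV[K]_n)
    (H : forall i : 'I_t, {fset 'X_{1..s i}}) (F : {mpoly K[n]}) : Prop :=
  forall (i : 'I_t) (h : 'X_{1..s i}),
    h \in H i -> (mdderiv (U i) h F).@[p i 0] = 0.

(* The library's idealr_closed also requires 1 not to belong to I, which fails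
   for [vanishing] when every H i is empty. *)
Definition is_ideal (R : comNzRingType) (I : R -> Prop) : Prop :=
  [/\ I 0, forall x y : R, I x -> I y -> I (x + y)
    & forall a x : R, I x -> I (a * x)].

(* Main.v *)
Require Import Defs.
From HB Require Import structures.
From mathcomp Require Import all_boot all_order all_algebra.

Set Implicit Arguments.
Unset Strict Implicit.
Unset Printing Implicit Defensive.

Import GRing.Theory.
Local Open Scope ring_scope.

(** The idea is to replace derivatives by Taylor expansions.  For directions
    [U_0, ..., U_(s-1)] at a point [p], the derivatives [D^(h) F (p)] are the
    coefficients of the polynomial [F(p + Y_0 U_0 + ... + Y_(s-1) U_(s-1))] in
    [s] new variables ([mcoeff_taylor]).  Since [taylor U p] is a ring morphism,
    the Leibniz rule is just multiplication of polynomials; in particular the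
    conditions [D^(h) F (p) = 0], for [h] in a set closed under subtraction, cut
    out an ideal.

    Interpolation at a single point is easy: linearly independent directions
    admit dual affine forms [L_j], which expand to the variables [Y_j]
    ([dual_coordinates]), so a combination of monomials in the [L_j] has any
    prescribed Taylor coefficients ([local_interpolation]).

    The single-point solutions are glued as in the Chinese remainder theorem.
    For each [i] there is a polynomial [E_i] that agrees with 1 at [p_i], and
    with 0 at every other [p_k], up to any given order [N]
    ([local_idempotent]): if [G] equals 1 at [p_i] and vanishes to order [N] at
    the other points, take [E_i = 1 - (1 - G)^N].  With [N] above the degrees
    of all the prescribed exponents, [\sum_i E_i * P_i] interpolates as soon
    as each [P_i] does so at [p_i].

    Coefficients in one direction at a time are directional derivatives by
    definition, so the iterated derivatives are reached by substituting the
    shifts [X := X + Y_j U_j] one after the other; this requires keeping [X]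
    as a variable, which is what [symbolic_taylor] does. *)

(** * Derivatives as Taylor coefficients *)

Lemma mpoly_rmorph_ext (K : comNzRingType) (n : nat) (R : nzRingType)
    (f g : {rmorphism {mpoly K[n]} -> R}) :
  (forall c : K, f c%:MP = g c%:MP) -> (forall k, f 'X_k = g 'X_k) -> f =1 g.
Proof.
move=> eqC eqX; elim/mpolyind => [|c m F _ _ IH]; first by rewrite !rmorph0.
rewrite !rmorphD IH -mul_mpolyC !rmorphM eqC mpolyXE_id !rmorph_prod.
by congr (_ * _ + _); apply: eq_bigr => k _; rewrite !rmorphXn eqX.
Qed.

Section Taylor.
Variables (K : fieldType) (n : nat).

Lemma shift_alongE (V : 'rV[K]_n) :
  shift_along V =
    mmap (polyC \o @mpolyC n K)
      (fun k : 'I_n => ('X_k : {mpoly K[n]})%:P + (V 0 k)%:MP *: 'X).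
Proof. by []. Qed.

HB.instance Definition _ (V : 'rV[K]_n) :=
  GRing.RMorphism.copy (shift_along V)
    (mmap (polyC \o @mpolyC n K)
      (fun k : 'I_n => ('X_k : {mpoly K[n]})%:P + (V 0 k)%:MP *: 'X)).

Variables (s : nat) (U : 'I_s -> 'rV[K]_n).

(** [F(X + \sum_(j <- l) Y_j U_j)], as a polynomial in the [Y_j] whose
    coefficients are polynomials in [X]. *)
Definition symbolic_taylor (l : seq 'I_s) :
    {mpoly K[n]} -> {mpoly {mpoly K[n]}[s]} :=
  mmap (@mpolyC s _ \o @mpolyC n K)
    (fun k => ('X_k)%:MP + \sum_(j <- l) (U j 0 k)%:MP%:MP * 'X_j).

HB.instance Definition _ l := GRing.RMorphism.on (symbolic_taylor l).

Lemma symbolic_taylorC l c : symbolic_taylor l c%:MP = c%:MP%:MP.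
Proof. by rewrite /symbolic_taylor mmapC. Qed.

Lemma symbolic_taylorX l k :
  symbolic_taylor l 'X_k
    = ('X_k)%:MP + \sum_(j <- l) (U j 0 k)%:MP%:MP * 'X_j.
Proof. by rewrite /symbolic_taylor mmapX mmap1U. Qed.

(** The substitution [X := X + Y_j U_j] in the coefficients; the variables
    [Y_k], including [Y_j], are left alone. *)
Definition substitute_shift (j : 'I_s) :
    {mpoly {mpoly K[n]}[s]} -> {mpoly {mpoly K[n]}[s]} :=
  mmap (symbolic_taylor [:: j]) (fun k => 'X_k).
HB.instance Definition _ j := GRing.RMorphism.on (substitute_shift j).

Lemma substitute_shiftC j F :
  substitute_shift j F%:MP = symbolic_taylor [:: j] F.
Proof. exact: mmapC. Qed.

Lemma substitute_shiftX j k : substitute_shift j 'X_k = 'X_k.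
Proof. by rewrite /substitute_shift mmapX mmap1U. Qed.

(** The outermost derivative of an iterated derivative is the last shift to be
    substituted, whence the order of this composition. *)
Lemma symbolic_taylor_cons j l F :
  symbolic_taylor (j :: l) F = substitute_shift j (symbolic_taylor l F).
Proof.
pose f : {rmorphism _ -> _} := symbolic_taylor (j :: l).
pose g : {rmorphism _ -> _} := substitute_shift j \o symbolic_taylor l.
apply: (mpoly_rmorph_ext (f := f) (g := g)) => [c|k]; rewrite /f /g /=.
  by rewrite !symbolic_taylorC substitute_shiftC symbolic_taylorC.
rewrite !symbolic_taylorX rmorphD rmorph_sum /= big_cons addrA.
rewrite substitute_shiftC symbolic_taylorX big_seq1; congr (_ + _).
apply: eq_bigr => i _.
by rewrite rmorphM /= substitute_shiftC symbolic_taylorC substitute_shiftX.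
Qed.

Lemma symbolic_taylor1 j F :
  symbolic_taylor [:: j] F
    = \sum_(d < size (shift_along (U j) F))
        (dderiv (U j) d F)%:MP * 'X_j ^+ d.
Proof.
pose f : {rmorphism _ -> _} := symbolic_taylor [:: j].
have comX : commr_rmorph (@mpolyC s {mpoly K[n]}) 'X_j.
  by move=> c; rewrite /GRing.comm mulrC.
pose g : {rmorphism _ -> _} := horner_morph comX \o shift_along (U j).
suff -> : symbolic_taylor [:: j] F = g F.
  rewrite /g /= /horner_morph.
  rewrite (@horner_coef_wide _ (size (shift_along (U j) F))).
    by apply: eq_bigr => d _; rewrite coef_map.
  exact: size_poly.
apply: (mpoly_rmorph_ext (f := f) (g := g)) => [c|k]; rewrite /f /g /=.
  by rewrite symbolic_taylorC shift_alongE mmapC /= horner_morphC.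
rewrite symbolic_taylorX big_seq1 shift_alongE mmapX mmap1U.
by rewrite rmorphD /= -mul_polyC rmorphM /= !horner_morphC horner_morphX.
Qed.

Lemma dderiv0p (V : 'rV[K]_n) d : dderiv V d 0 = 0.
Proof. by rewrite /dderiv rmorph0 coef0. Qed.

(** If [Y_j] does not occur in [Q], then the powers of [Y_j] in the result all
    come from the shift, so the exponent of [Y_j] counts the order of the
    derivative and the other exponents locate the coefficient of [Q]. *)
Lemma mcoeff_substitute_shift j (Q : {mpoly {mpoly K[n]}[s]}) (h : 'X_{1..s}) :
    (forall m : 'X_{1..s}, m j != 0%N -> Q@_m = 0) ->
  (substitute_shift j Q)@_h
    = dderiv (U j) (h j) Q@_(h - U_(j) *+ h j).
Proof.
move=> Qj.
have supp0 m : m \in msupp Q -> m j = 0%N.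
  rewrite mcoeff_msupp; case: (eqVneq (m j) 0%N) => // mj.
  by rewrite Qj // eqxx.
(* [m0] is [h] with its [j]-th entry set to 0. *)
set m0 := (h - _)%MM.
have term m : m \in msupp Q ->
    (symbolic_taylor [:: j] Q@_m * 'X_[m])@_h
      = if m == m0 then dderiv (U j) (h j) Q@_m else 0.
  move=> /supp0 mj0; rewrite symbolic_taylor1 mulr_suml raddf_sum /=.
  have eqh (d : nat) : ((U_(j) *+ d + m)%MM == h) = (m == m0) && (d == h j).
    apply/eqP/andP => [hE|[/eqP -> /eqP ->]].
      have hjE : h j = d.
        by rewrite -hE mnmDE mulmnE mnm1E eqxx mul1n mj0 addn0.
      by rewrite /m0 hjE -hE addmC addmK !eqxx.
    apply/mnmP => i; rewrite mnmDE mulmnE mnm1E mnmBE mulmnE mnm1E.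
    by case: (j =P i) => [<-|_]; rewrite ?mul0n ?mul1n ?subn0 // ?subnn addn0.
  have coefE (d : nat) : ((dderiv (U j) d Q@_m)%:MP * 'X_j ^+ d * 'X_[m])@_h
      = if (m == m0) && (d == h j) then dderiv (U j) d Q@_m else 0.
    rewrite mpolyXn -mulrA -mpolyXD mcoeffCM mcoeffX eqh.
    by case: ifP => _; rewrite ?mulr1 ?mulr0.
  under eq_bigr do rewrite coefE.
  case: (m == m0) => /=; last by rewrite big1.
  rewrite -big_mkcond /=.
  case: (ltnP (h j) (size (shift_along (U j) Q@_m))) => hj.
    by rewrite (big_pred1 (Ordinal hj)).
  rewrite big_pred0; first by rewrite /dderiv nth_default.
  by move=> d; apply/negbTE; rewrite neq_ltn (leq_trans (ltn_ord d) hj).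
rewrite /substitute_shift /mmap raddf_sum /= big_seq.
under eq_bigr => m mQ do rewrite mmap1_id term //.
rewrite -big_seq -big_mkcond /=.
case: (boolP (m0 \in msupp Q)) => m0Q.
  by rewrite -big_filter filter_pred1_uniq ?msupp_uniq // big_seq1.
rewrite (memN_msupp_eq0 m0Q) dderiv0p big_seq_cond big1 //.
move=> m /andP[mQ /eqP mE].
by move: m0Q; rewrite -mE mQ.
Qed.

(** The zero case records that only the variables [Y_j] with [j] in [l] occur:
    the induction needs it to apply [mcoeff_substitute_shift], and [uniq l]
    makes the next variable a new one. *)
Lemma mcoeff_symbolic_taylor l (F : {mpoly K[n]}) (h : 'X_{1..s}) : uniq l ->
  (symbolic_taylor l F)@_h
    = if [forall j, (j \notin l) ==> (h j == 0%N)]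
      then foldr (fun j G => dderiv (U j) (h j) G) F l else 0.
Proof.
elim: l h => [|j l IH] h /=.
  move=> _.
  have -> : symbolic_taylor [::] F = F%:MP.
    pose f : {rmorphism _ -> _} := symbolic_taylor [::].
    pose g : {rmorphism _ -> _} := @mpolyC s {mpoly K[n]}.
    apply: (mpoly_rmorph_ext (f := f) (g := g)) => [c|k]; rewrite /f /g /=.
      by rewrite symbolic_taylorC.
    by rewrite symbolic_taylorX big_nil addr0.
  rewrite mcoeffC.
  have -> : [forall j, (j \notin [::]) ==> (h j == 0%N)] = (h == 0%MM).
    apply/forallP/eqP => [h0|-> j]; last by rewrite mnm0E.
    by apply/mnmP => j; rewrite mnm0E (eqP (h0 j)).
  by case: ifP; rewrite ?mulr1 ?mulr0.
case/andP=> jl ul; rewrite symbolic_taylor_cons.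
rewrite mcoeff_substitute_shift; last first.
  move=> m mj; rewrite IH // ifF //; apply/negbTE/forallPn; exists j.
  by rewrite jl.
rewrite IH //.
set m := (h - _)%MM.
have mE i : m i = if i == j then 0%N else h i.
  rewrite mnmBE mulmnE mnm1E eq_sym.
  by case: eqP => [->|_]; rewrite ?mul1n ?mul0n ?subnn ?subn0.
have -> : [forall i, (i \notin l) ==> (m i == 0%N)]
    = [forall i, (i \notin j :: l) ==> (h i == 0%N)].
  apply: eq_forallb => i; rewrite mE inE negb_or.
  by case: (i == j) => //=; rewrite implybT.
case: ifP => _; last exact: dderiv0p.
(* [m] and [h] differ at [j] only, and [j] does not occur in [l]. *)
suff -> : foldr (fun i G => dderiv (U i) (m i) G) F l
    = foldr (fun i G => dderiv (U i) (h i) G) F l by [].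
elim: l jl {IH ul} => [//|i l IHl]; rewrite inE negb_or => /andP[ji jl].
rewrite [LHS]/= [RHS]/= IHl //.
have -> // : m i = h i.
by rewrite mE eq_sym (negbTE ji).
Qed.

Variable (p : 'rV[K]_n).

Definition taylor : {mpoly K[n]} -> {mpoly K[s]} :=
  mmap (@mpolyC s K) (fun k => (p 0 k)%:MP + \sum_j U j 0 k *: 'X_j).
HB.instance Definition _ := GRing.RMorphism.on taylor.

Lemma taylorC c : taylor c%:MP = c%:MP.
Proof. by rewrite /taylor mmapC. Qed.

Lemma taylorX k : taylor 'X_k = (p 0 k)%:MP + \sum_j U j 0 k *: 'X_j.
Proof. by rewrite /taylor mmapX mmap1U. Qed.

(** Both sides become ring morphisms in [F] once the right-hand side is seen as
    the evaluation at [p] of a coefficient of the symbolic expansion along all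
    the directions. *)
Lemma mcoeff_taylor F h : (taylor F)@_h = (mdderiv U h F).@[p 0].
Proof.
pose f : {rmorphism _ -> _} := taylor.
pose g : {rmorphism _ -> _} :=
  map_mpoly (meval (p 0)) \o symbolic_taylor (enum 'I_s).
have -> : taylor F = g F.
  apply: (mpoly_rmorph_ext (f := f) (g := g)) => [c|k]; rewrite /f /g /=.
    by rewrite taylorC symbolic_taylorC map_mpolyC /= mevalC.
  rewrite taylorX symbolic_taylorX rmorphD rmorph_sum /= map_mpolyC /= mevalXU.
  rewrite big_enum; congr (_ + _); apply: eq_bigr => j _.
  by rewrite rmorphM /= map_mpolyC /= mevalC map_mpolyX mul_mpolyC.
rewrite /g /= mcoeff_map_mpoly mcoeff_symbolic_taylor ?enum_uniq // ifT //.
by apply/forallP => j; rewrite mem_enum.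
Qed.
End Taylor.

(** * Order of vanishing *)

Section Order.
Variables (R : comNzRingType) (s : nat).
Implicit Types P Q : {mpoly R[s]}.

Lemma mcoeffM_eq0 P Q m :
  (forall k l : 'X_{1..s}, m = (k + l)%MM -> P@_k * Q@_l = 0) -> (P * Q)@_m = 0.
Proof. by move=> PQ0; rewrite mcoeffM big1 // => k /eqP/PQ0. Qed.

Definition order_ge (N : nat) P := forall m, (mdeg m < N)%N -> P@_m = 0.

Lemma order_geM a b P Q :
  order_ge a P -> order_ge b Q -> order_ge (a + b) (P * Q).
Proof.
move=> Pa Qb m ltm; apply: mcoeffM_eq0 => k l mE.
have [lta|lea] := ltnP (mdeg k) a; first by rewrite Pa ?mul0r.
rewrite Qb ?mulr0 // -(ltn_add2l a) (leq_ltn_trans _ ltm) //.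
by rewrite mE mdegD leq_add2r.
Qed.

Lemma order_geMl N P Q : order_ge N Q -> order_ge N (P * Q).
Proof. by move=> QN; apply: (@order_geM 0 N). Qed.

Lemma order_ge1X N P : order_ge 1 P -> order_ge N (P ^+ N).
Proof.
move=> P1; elim: N => [|N IH]; first by [].
by rewrite exprS -add1n; apply: order_geM.
Qed.

Lemma order_ge1P P : P@_0 = 0 -> order_ge 1 P.
Proof. by move=> P0 m; rewrite ltnS leqn0 mdeg_eq0 => /eqP ->. Qed.

Lemma order_geN N P : order_ge N P -> order_ge N (- P).
Proof. by move=> PN m ltm; rewrite mcoeffN PN ?oppr0. Qed.

End Order.

(** The constant Taylor coefficient is the value at [p]. *)
Lemma order_ge_taylor1 (K : fieldType) n s (U : 'I_s -> 'rV[K]_n)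
    (p : 'rV[K]_n) (F : {mpoly K[n]}) :
  F.@[p 0] = 0 -> order_ge 1 (taylor U p F).
Proof.
move=> Fp0; apply: order_ge1P; rewrite -[RHS]Fp0.
pose f : {rmorphism _ -> _} := mcoeff 0%MM \o taylor U p.
pose g : {rmorphism _ -> _} := meval (p 0).
apply: (mpoly_rmorph_ext (f := f) (g := g)) => [c|k]; rewrite /f /g /=.
  by rewrite taylorC mcoeffC eqxx mulr1 mevalC.
rewrite taylorX mevalXU mcoeffD mcoeffC eqxx mulr1 raddf_sum /=.
rewrite big1 ?addr0 // => j _.
by rewrite mcoeffZ mcoeffX mnm1_eq0 mulr0.
Qed.

(** * Local idempotents *)

Lemma separating_mpoly (K : fieldType) n (a b : 'rV[K]_n) :
  a != b -> exists g : {mpoly K[n]}, g.@[a 0] = 1 /\ g.@[b 0] = 0.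
Proof.
move=> ab.
have [k abk] : exists k, a 0 k != b 0 k.
  apply/existsP; apply: contraR ab; rewrite negb_exists => /forallP eqab.
  by apply/eqP/rowP => k; move: (eqab k); rewrite negbK => /eqP.
exists ((a 0 k - b 0 k)^-1 *: ('X_k - (b 0 k)%:MP)).
rewrite !mevalZ !mevalB !mevalXU !mevalC subrr mulr0 mulVf //.
by rewrite subr_eq0.
Qed.

(** The approximation is uniform in the number and the choice of directions,
    so that the points may carry different ones.  At [p_i] it holds because
    [1 - E = (1 - G) ^+ N] and [1 - G] vanishes there; elsewhere because [E]
    is divisible by [G], which has as a factor the [N]-th power of a polynomial
    vanishing there. *)
Lemma local_idempotent (K : fieldType) n t (p : 'I_t -> 'rV[K]_n)
    (hp : forall i j : 'I_t, i != j -> p i != p j) (N : nat) (i : 'I_t) :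
  exists E : {mpoly K[n]}, forall k s (U : 'I_s -> 'rV[K]_n),
    order_ge N (taylor U (p k) E - (k == i)%:R).
Proof.
(* The implication stands below the existential so that [g] is a total family,
   as [fin_all_exists] requires. *)
have sep k : exists g : {mpoly K[n]}, k != i ->
    g.@[p i 0] = 1 /\ g.@[p k 0] = 0.
  have [->|ki] := eqVneq k i; first by exists 0.
  have [|g gP] := @separating_mpoly _ _ (p i) (p k); last by exists g.
  by apply: hp; rewrite eq_sym.
have [g gP] := fin_all_exists sep.
pose G := \prod_(k | k != i) g k ^+ N.
have Gi : (1 - G).@[p i 0] = 0.
  rewrite mevalB rmorph1 rmorph_prod big1 ?subrr //= => k ki.
  by rewrite rmorphXn /= (gP _ ki).1 expr1n.
exists (1 - (1 - G) ^+ N) => k s U.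
have TE : taylor U (p k) (1 - (1 - G) ^+ N)
    = 1 - taylor U (p k) (1 - G) ^+ N.
  by rewrite rmorphB rmorph1 rmorphXn.
rewrite TE; have [->|ki] := eqVneq k i.
  rewrite addrAC subrr add0r; apply: order_geN.
  exact/order_ge1X/order_ge_taylor1.
rewrite subr0 -opprB subrX1; apply: order_geN; rewrite mulrC.
apply: order_geMl.
have -> : taylor U (p k) (1 - G) - 1 = - taylor U (p k) G.
  by rewrite rmorphB rmorph1 addrAC subrr add0r.
apply: order_geN; rewrite /G (bigD1 k) //= mulrC rmorphM rmorphXn.
by apply/order_geMl/order_ge1X/order_ge_taylor1; case: (gP _ ki).
Qed.

(** * Interpolation *)

(** The columns of a right inverse [W] of the matrix of directions are linear
    forms dual to them; centred at [p], they expand to the variables. *)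
Lemma dual_coordinates (K : fieldType) n s (U : 'I_s -> 'rV[K]_n)
    (p : 'rV[K]_n) : free [seq U j | j <- enum 'I_s] ->
  exists L : 'I_s -> {mpoly K[n]}, forall j, taylor U p (L j) = 'X_j.
Proof.
move=> freeU; pose M := \matrix_(i < s, k < n) U i 0 k.
have freeM : row_free M.
  apply: inj_row_free => c cM0; apply/rowP => j; rewrite mxE.
  have /freeP freeU' : free [tuple U i | i < s] by [].
  apply: (freeU' (c 0)); rewrite -[RHS]cM0; apply/rowP => k.
  rewrite summxE mxE; apply: eq_bigr => i _.
  by rewrite -tnth_nth tnth_mktuple !mxE.
have [W MW] := row_freeP freeM.
exists (fun j => \sum_k (W k j)%:MP * ('X_k - (p 0 k)%:MP)) => j.
have taylorXB k : taylor U p ('X_k - (p 0 k)%:MP) = \sum_i U i 0 k *: 'X_i.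
  by rewrite rmorphB /= taylorX taylorC addrAC subrr add0r.
rewrite rmorph_sum /=.
under eq_bigr => k _ do
  rewrite rmorphM /= taylorC taylorXB mul_mpolyC scaler_sumr.
have dualE i : \sum_k W k j *: (U i 0 k *: 'X_i)
    = (i == j)%:R *: 'X_i :> {mpoly K[s]}.
  rewrite -[(i == j)%:R](_ : (M *m W) i j = _); last by rewrite MW mxE.
  rewrite mxE scaler_suml; apply: eq_bigr => k _.
  by rewrite scalerA mxE mulrC.
rewrite exchange_big; under eq_bigr do rewrite dualE.
rewrite (bigD1 j) //= eqxx scale1r big1 ?addr0 // => i /negbTE ->.
by rewrite scale0r.
Qed.

(** In the dual coordinates at [p], this is the polynomial with coefficients
    [w a]. *)
Lemma local_interpolation (K : fieldType) n s (U : 'I_s -> 'rV[K]_n)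
    (p : 'rV[K]_n) (A : {fset 'X_{1..s}}) (w : 'X_{1..s} -> K) :
  free [seq U j | j <- enum 'I_s] ->
  exists P : {mpoly K[n]}, forall h, h \in A -> (taylor U p P)@_h = w h.
Proof.
move=> /(dual_coordinates p) [L taylorL].
exists (\sum_(a <- A) (w a)%:MP * \prod_j L j ^+ a j) => h hA.
rewrite rmorph_sum raddf_sum /= (bigD1_seq h) ?fset_uniq //=.
have coefE a : (taylor U p ((w a)%:MP * \prod_j L j ^+ a j))@_h
    = w a * (a == h)%:R.
  rewrite rmorphM /= taylorC rmorph_prod mcoeffCM -mcoeffX mpolyXE_id.
  by congr (_ * mcoeff _ _); apply: eq_bigr => j _; rewrite rmorphXn /= taylorL.
rewrite coefE eqxx mulr1 big1 ?addr0 // => a ah.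
by rewrite coefE (negbTE ah) mulr0.
Qed.

Theorem theorem2p1 (K : fieldType) (n t : nat) (hn : (1 <= n)%N) (ht : (1 <= t)%N)
    (p : 'I_t -> 'rV[K]_n) (hp : forall i j : 'I_t, i != j -> p i != p j)
    (s : 'I_t -> nat) (hs : forall i : 'I_t, (1 <= s i)%N)
    (U : forall i : 'I_t, 'I_(s i) -> 'rV[K]_n)
    (hUfree : forall i : 'I_t, free [seq U i j | j <- enum 'I_(s i)])
    (hUunit : forall (i : 'I_t) (j : 'I_(s i)), unitary (U i j))
    (H : forall i : 'I_t, {fset 'X_{1..s i}})
    (hH : forall i : 'I_t, closed_under_sub (H i))
    (v : forall i : 'I_t, 'X_{1..s i} -> K) :
  [/\ is_ideal (vanishing p U H),
      exists F : {mpoly K[n]}, interpolates p U H v F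
    & forall F1 F2 : {mpoly K[n]},
        interpolates p U H v F1 -> interpolates p U H v F2 ->
        vanishing p U H (F1 - F2)].
Proof.
split.
- split=> [i h _|F G F0 G0 i h hi|a F F0 i h hi]; rewrite -mcoeff_taylor.
  + by rewrite rmorph0 mcoeff0.
  + by rewrite rmorphD mcoeffD !mcoeff_taylor F0 // G0 // addr0.
  rewrite rmorphM; apply: mcoeffM_eq0 => k l hE.
  rewrite [X in _ * X]mcoeff_taylor F0 ?mulr0 //.
  have -> : l = (h - k)%MM by rewrite hE addmC addmK.
  by apply: hH; rewrite // hE lem_addr.
- pose N := (\max_i \max_(h <- H i) (mdeg h).+1)%N.
  have ltN i h : h \in H i -> (mdeg h < N)%N.
    move=> hi; apply: leq_trans (leq_bigmax i).
    by rewrite (bigD1_seq h) ?fset_uniq //= leq_maxl.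
  have [E EP] := fin_all_exists (local_idempotent hp N).
  have [P PP] := fin_all_exists
    (fun i => local_interpolation (p i) (H i) (v i) (hUfree i)).
  exists (\sum_i E i * P i) => k h hk.
  rewrite -mcoeff_taylor -[RHS]PP // rmorph_sum raddf_sum /= (bigD1 k) //=.
  (* Only degrees below [N] matter at [h], and there [E i] is [k == i]. *)
  have small i : ((taylor (U k) (p k) (E i) - (k == i)%:R)
      * taylor (U k) (p k) (P i))@_h = 0.
    by rewrite mulrC (order_geMl _ (EP i k _ (U k))) // (ltN k).
  rewrite big1 ?addr0 => [|i ik].
    apply/eqP; rewrite rmorphM -subr_eq0 -mcoeffB -(small k) eqxx.
    by rewrite mulrBl mul1r.
  by rewrite rmorphM -[RHS](small i) eq_sym (negbTE ik) subr0.
move=> F G FP GP i h hi.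
by rewrite -mcoeff_taylor rmorphB mcoeffB !mcoeff_taylor FP // GP // subrr.
Qed.
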